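(* Let $X$ be a directed ordered vector space and let $Z$ be a pre-Riesz space with a vector lattice cover $(Y,i)$. If $T\in L_{oc}(X,Z)$, then $i\circ T\in L_{oc}(X,Y)$.
   Context: All vector spaces are real. An ordered vector space is a real vector space $X$ with a cone $X_+$ (closed under nonnegative linear combinations, with $X_+\cap(-X_+)=\{0\}$), ordered by $x\le y$ iff $y-x\in X_+$. It is directed if any two elements have a common upper bound (equivalently $X=X_+-X_+$). A linear map $i\colon X\to Y$ between ordered vector spaces is bipositive if for every $x\in X$: $i(x)\ge 0$ iff $x\ge 0$. A linear subspace $D$ of an ordered vector space $Y$ is order dense in $Y$ if for every $y\in Y$ the infimum of $\{z\in D : y\le z\}$ exists in $Y$ and equals $y$. An ordered vector space $Z$ is a pre-Riesz space if there exist a vector lattice $Y$ and a bipositive linear map $i\colon Z\to Y$ such that $i(Z)$ is order dense in $Y$; then $(Y,i)$ is called a vector lattice cover of $Z$. For a net, $z_\alpha\downarrow 0$ means that $\alpha\le\beta$ implies $z_\alpha\ge z_\beta$ and $\inf_\alpha z_\alpha=0$. A net $(x_\alpha)_\alpha$ in $X$ order converges to $x\in X$ if there is a net $(z_\alpha)_\alpha$ in $X$ (with the same index set) such that $z_\alpha\downarrow 0$ and $\pm(x-x_\alpha)\le z_\alpha$ for every $\alpha$. A linear operator $T\colon X\to Z$ is order continuous if for every net $(x_\alpha)_\alpha$ in $X$ that order converges to some $x\in X$, the net $(T(x_\alpha))_\alpha$ order converges to $T(x)$ in $Z$. $L_{oc}(X,Z)$ denotes the set of all order continuous linear operators from $X$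 to $Z$. *)

(* Defs.v *)
From HB Require Import structures.
From mathcomp Require Import all_boot all_order all_algebra.
From mathcomp Require Import boolp classical_sets reals.

Set Implicit Arguments.
Unset Strict Implicit.
Unset Printing Implicit Defensive.

Import Order.TTheory GRing.Theory Num.Theory.
Local Open Scope classical_set_scope.
Local Open Scope ring_scope.

(* The positive cone is {x | 0 <= x}: the mixin says that the order is the one
   induced by it and that it is closed under nonnegative linear combinations;
   that it meets its opposite only in 0 is antisymmetry of the order. *)
HB.mixin Record Lmodule_isOrdered (R : realType) V
    of GRing.Lmodule R V & Num.POrderedZmodule V := {
  lev_subv_ge0 : forall x y : V, (x <= y) = (0 <= y - x);
  addv_ge0 : forall x y : V, 0 <= x -> 0 <= y -> 0 <= x + y;
  scalev_ge0 : forall (a : R) (x : V), 0 <= a -> 0 <= x -> 0 <= a *: x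
}.

#[short(type="orderedLmodType")]
HB.structure Definition OrderedLmodule (R : realType) :=
  { V of Lmodule_isOrdered R V & GRing.Lmodule R V & Num.POrderedZmodule V }.

Definition directed_space (R : realType) (X : orderedLmodType R) : Prop :=
  forall x y : X, exists z : X, x <= z /\ y <= z.

Definition vector_lattice (R : realType) (Y : orderedLmodType R) : Prop :=
  forall x y : Y, supremums [set x; y] !=set0 /\ infimums [set x; y] !=set0.

Definition bipositive (R : realType) (X Y : orderedLmodType R)
    (i : {linear X -> Y}) : Prop :=
  forall x : X, (0 <= i x) = (0 <= x).

(* Only meant for D a linear subspace, such as the range of a linear map. *)
Definition order_dense (R : realType) (Y : orderedLmodType R) (D : set Y)
    : Prop :=
  forall y : Y, infimums [set z | D z /\ y <= z] y.

Definition vector_lattice_cover (R : realType) (Z Y : orderedLmodType R)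
    (i : {linear Z -> Y}) : Prop :=
  [/\ vector_lattice Y, bipositive i & order_dense (range i)].

Definition pre_riesz (R : realType) (Z : orderedLmodType R) : Prop :=
  exists (Y : orderedLmodType R) (i : {linear Z -> Y}),
    vector_lattice_cover i.

(* Index sets of nets are nonempty and preordered; antisymmetry is not
   required. *)
Record directed_index (I : Type) (le : I -> I -> Prop) : Prop := {
  directed_index_inhabited : inhabited I;
  directed_index_refl : forall a, le a a;
  directed_index_trans : forall a b c, le a b -> le b c -> le a c;
  directed_index_ub : forall a b, exists c, le a c /\ le b c
}.

Definition decreases_to0 (R : realType) (X : orderedLmodType R)
    (I : Type) (le : I -> I -> Prop) (z : I -> X) : Prop :=
  (forall a b, le a b -> z b <= z a) /\ infimums (range z) 0.

Definition order_converges (R : realType) (X : orderedLmodType R)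
    (I : Type) (le : I -> I -> Prop) (u : I -> X) (x : X) : Prop :=
  exists z : I -> X, decreases_to0 le z /\
    forall a, x - u a <= z a /\ - (x - u a) <= z a.

Definition order_continuous (R : realType) (X Z : orderedLmodType R)
    (T : {linear X -> Z}) : Prop :=
  forall (I : Type) (le : I -> I -> Prop), directed_index le ->
  forall (u : I -> X) (x : X),
    order_converges le u x -> order_converges le (fun a => T (u a)) (T x).

Definition L_oc (R : realType) (X Z : orderedLmodType R)
    : set {linear X -> Z} :=
  [set T | order_continuous T].

Arguments L_oc {R} X Z _.

(* Main.v *)
Require Import Defs.
From HB Require Import structures.
From mathcomp Require Import all_boot all_order all_algebra.
From mathcomp Require Import boolp classical_sets reals.

Set Implicit Arguments.
Unset Strict Implicit.
Unset Printing Implicit Defensive.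

Import Order.TTheory GRing.Theory Num.Theory.
Local Open Scope classical_set_scope.
Local Open Scope ring_scope.

(** The embedding [i] preserves order convergence, so composing it with [T] keeps order continuity.
    If [z] dominates the error of a net in the small space, [i \o z] dominates it in the cover,
    since [i] preserves and reflects the order. The crux, [order_dense_decreases_to0], is that the
    infimum 0 survives among the additional elements of the larger space: a lower bound [y] of
    [i \o z] is, by order density, the supremum of the image elements below it, and each of these is
    at most 0. *)

Section OrderedLmodule.
Variable R : realType.
Implicit Types X Y : orderedLmodType R.

Lemma bipositive_le X Y (i : {linear X -> Y}) :
  bipositive i -> forall x y : X, (i x <= i y) = (x <= y).
Proof. by move=> hi x y; rewrite lev_subv_ge0 -linearB hi -lev_subv_ge0. Qed.

Lemma lev_oppl Y (x y : Y) : (- x <= y) = (- y <= x).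
Proof. by rewrite lev_subv_ge0 [RHS]lev_subv_ge0 !opprK addrC. Qed.

Lemma order_dense_decreases_to0 X Y (i : {linear X -> Y})
    (I : Type) (le : I -> I -> Prop) (z : I -> X) :
  bipositive i -> order_dense (range i) ->
  decreases_to0 le z -> decreases_to0 le (i \o z).
Proof.
move=> bi di [mono [lb0 glb0]]; have lei := bipositive_le bi.
split; first by move=> a b /mono; rewrite /= lei.
split.
  by move=> _ [a _ <-] /=; rewrite bi; apply: lb0; exists a.
move=> y yz.
(* Order density at [- y] says that [y] is the supremum of the elements of
   [range i] below it. *)
have [_ glby] := di (- y).
suff: 0 <= - y by rewrite [y <= 0]lev_subv_ge0 sub0r.
apply: glby => _ [[w _ <-]]; rewrite lev_oppl -linearN bi => wy.
suff: - w <= 0 by rewrite lev_oppl oppr0.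
(* [- w] is a lower bound of [z], because [i (- w) <= y <= i (z a)] and [i] reflects the order. *)
apply: glb0 => _ [a _ <-]; rewrite -lei.
by apply: le_trans wy (yz _ _); exists a.
Qed.

Lemma order_dense_order_converges X Y (i : {linear X -> Y})
    (I : Type) (le : I -> I -> Prop) (u : I -> X) (x : X) :
  bipositive i -> order_dense (range i) ->
  order_converges le u x -> order_converges le (i \o u) (i x).
Proof.
move=> bi di [z [z0 xz]]; exists (i \o z).
split; first exact: order_dense_decreases_to0.
by move=> a; rewrite /= -linearB -linearN !bipositive_le.
Qed.

End OrderedLmodule.

Theorem theorem13 (R : realType) (X Z : orderedLmodType R)
    (hX : directed_space X) (hZ : pre_riesz Z)
    (Y : orderedLmodType R) (i : {linear Z -> Y})
    (hi : vector_lattice_cover i) (T : {linear X -> Z}) :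
  L_oc X Z T -> L_oc X Y (i \o T : {linear X -> Y}).
Proof.
have [_ bi di] := hi => hT I le dI u x ux.
exact: order_dense_order_converges bi di (hT I le dI u x ux).
Qed.
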